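(* Let $M$ be $\mathbb{R}^3$ or $S^3$ with a fixed Riemannian metric and $K$ a knot type in $M$. Let $G$ be a topological group acting continuously on $M$ by isometries preserving $\mathcal{E}_K(M)$, let $\gamma_*\in\mathcal{E}_K(M)$, $\Lambda_*=\operatorname{Rop}(\gamma_* )$, and let $$o:G\to\mathcal{E}_K(M),\qquad g\mapsto g\circ\gamma_*,$$ be the orbit map, with image $O=G\cdot\gamma_*$. Then $\operatorname{Rop}\equiv\Lambda_*$ on $O$, and consequently: (i) every class in $\operatorname{im}[o_*:\pi_i(G,e)\to\pi_i(\mathcal{E}_K(M),\gamma_* )]$ (for $i\ge1$) has excess width $0$; (ii) more generally, if the inclusion $O\hookrightarrow\mathcal{E}_K(M)$ is surjective on $\pi_i$ (based at $\gamma_*$) for some $i\ge1$, then $\mathfrak{w}_i^K(\alpha;\gamma_* )=\Lambda_*$ for every $\alpha\in\pi_i(\mathcal{E}_K(M),\gamma_* )$; that is, $\ell_i^K(-;\gamma_* )\equiv0$ and $\sigma_i(K;\gamma_* )=\Lambda_*$.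
   Context: $\operatorname{Emb}^\infty(S^1,M)$ is the space of smooth embeddings with the $C^\infty$ topology; $\mathcal{E}_K(M)$ is its path component consisting of embeddings of (oriented) knot type $K$. For an embedded closed curve $\gamma$ in $M$, $\operatorname{Len}(\gamma)$ is its length and its thickness $\operatorname{Thi}(\gamma)$ is the normal injectivity radius: the supremum of the radii for which the normal exponential map of $\gamma$ is an embedding. The ropelength is $\operatorname{Rop}(\gamma)=\operatorname{Len}(\gamma)/\operatorname{Thi}(\gamma)$. For $i\ge1$ and $\alpha\in\pi_i(\mathcal{E}_K(M),\gamma_* )$ the ropelength width is $$\mathfrak{w}_i^K(\alpha;\gamma_* )=\inf\Bigl\{\sup_{z\in S^i}\operatorname{Rop}(F(z)):\ F:(S^i,* )\to(\mathcal{E}_K(M),\gamma_* )\text{ continuous},\ [F]=\alpha\Bigr\},$$ the excess width is $\ell_i^K(\alpha;\gamma_* )=\mathfrak{w}_i^K(\alpha;\gamma_* )-\Lambda_*$, and the stabilisation level is $\sigma_i(K;\gamma_* )=\sup_{\alpha\in\pi_i(\mathcal{E}_K(M),\gamma_* )}\mathfrak{w}_i^K(\alpha;\gamma_* )$. *)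

(* Defs.v *)
From HB Require Import structures.
From mathcomp Require Import all_boot all_order all_algebra.
From mathcomp Require Import all_classical all_reals all_analysis.

Set Implicit Arguments.
Unset Strict Implicit.
Unset Printing Implicit Defensive.

Import Order.TTheory GRing.Theory Num.Theory.
Import numFieldNormedType.Exports.

Local Open Scope ring_scope.
Local Open Scope classical_set_scope.

HB.mixin Record isTopologicalGroup G of Group G & Topological G := {
  mulg_continuous : continuous (fun p : G * G => (p.1 * p.2)%g) ;
  invg_continuous : continuous (fun x : G => (x^-1)%g) }.

#[short(type="topologicalGroupType")]
HB.structure Definition TopologicalGroup :=
  {G of Group G & Topological G & isTopologicalGroup G}.

Section Smooth.
Context {R : realType}.

(* With all points of an open set satisfying [smooth_at f], the function f is
   C^infinity there: all iterated directional derivatives are differentiable. *)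
Definition smooth_at (V W : normedModType R) (f : V -> W) (x : V) : Prop :=
  forall s : seq V, differentiable (foldr (fun v h => 'D_v h) f s) x.

(* Smoothness on an arbitrary subset A of a normed space (Milnor): near every
   point of A, f is the restriction to A of a C^infinity map defined on an open
   set. For A a submanifold this is the usual notion; values of f outside A
   are irrelevant. *)
Definition smooth_on (V W : normedModType R) (A : set V) (f : V -> W) : Prop :=
  forall x, A x -> exists (U : set V) (F : V -> W),
    [/\ open U, U x, forall y, U y -> smooth_at F y
      & forall y, U y -> A y -> F y = f y].

(* A diffeomorphism of A onto its image f(A), in the sense of [smooth_on]. *)
Definition smooth_embedding (V W : normedModType R) (A : set V) (f : V -> W) :
    Prop :=
  smooth_on A f /\
  exists f' : W -> V, smooth_on (f @` A) f' /\ forall x, A x -> f' (f x) = x.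

Definition smooth_curve_in (n : nat) (M : set 'rV[R]_n) (c : R -> 'rV[R]_n) :
    Prop :=
  smooth_on [set: R] c /\ forall t, M (c t).

(* T_x M, for a submanifold M of R^n, as a set of vectors of R^n. *)
Definition tangent (n : nat) (M : set 'rV[R]_n) (x : 'rV[R]_n) :
    set 'rV[R]_n :=
  [set v | exists c, [/\ smooth_curve_in M c, c 0 = x & derive1 c 0 = v]].

End Smooth.

Section Riemannian.
Context {R : realType}.

Definition bilin (n : nat) (A : 'M[R]_n) (u v : 'rV[R]_n) : R :=
  (u *m A *m v^T) 0 0.

(* The inner product on T_x M is the restriction to T_x M of [bilin (g x)];
   values of [bilin (g x)] on other vectors of R^n are irrelevant. *)
Definition riemannian_metric (n : nat) (M : set 'rV[R]_n)
    (g : 'rV[R]_n -> 'M[R]_n) : Prop :=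
  [/\ smooth_on M g,
      forall x u v, M x -> tangent M x u -> tangent M x v ->
        bilin (g x) u v = bilin (g x) v u
    & forall x u, M x -> tangent M x u -> u != 0 -> 0 < bilin (g x) u u].

(* A local parametrisation of the 3-manifold M, i.e. the inverse of a chart. *)
Definition local_param (n : nat) (M : set 'rV[R]_n) (U : set 'rV[R]_3)
    (psi : 'rV[R]_3 -> 'rV[R]_n) : Prop :=
  [/\ open U, smooth_embedding U psi
    & exists V : set 'rV[R]_n, open V /\ psi @` U = M `&` V].

Definition coord_vec (i : 'I_3) : 'rV[R]_3 := delta_mx 0 i.

Definition pullback (n : nat) (g : 'rV[R]_n -> 'M[R]_n)
    (psi : 'rV[R]_3 -> 'rV[R]_n) (y : 'rV[R]_3) : 'M[R]_3 :=
  \matrix_(i, j)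
    bilin (g (psi y)) ('D_(coord_vec i) psi y) ('D_(coord_vec j) psi y).

Definition christoffel (h : 'rV[R]_3 -> 'M[R]_3) (k i j : 'I_3)
    (y : 'rV[R]_3) : R :=
  2^-1 * \sum_l invmx (h y) k l *
    ('D_(coord_vec i) (fun z => h z j l) y +
     'D_(coord_vec j) (fun z => h z i l) y -
     'D_(coord_vec l) (fun z => h z i j) y).

(* The geodesic equation, required in every chart that meets the curve; y is
   the coordinate expression of c near t. *)
Definition geodesic (n : nat) (M : set 'rV[R]_n) (g : 'rV[R]_n -> 'M[R]_n)
    (J : set R) (c : R -> 'rV[R]_n) : Prop :=
  [/\ smooth_on J c, forall t, J t -> M (c t)
    & forall U psi, local_param M U psi ->
      forall (y : R -> 'rV[R]_3) (t : R), J t ->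
      (\forall s \near t, U (y s) /\ psi (y s) = c s) ->
      forall k : 'I_3,
        (derive1n 2 y t) 0 k +
        \sum_i \sum_j christoffel (pullback g psi) k i j (y t) *
                      (derive1 y t) 0 i * (derive1 y t) 0 j = 0].

(* The graph of the Riemannian exponential map: exp_x v is defined and equal
   to q. The metric need not be complete, so exp is only partially defined. *)
Definition is_exp (n : nat) (M : set 'rV[R]_n) (g : 'rV[R]_n -> 'M[R]_n)
    (x v q : 'rV[R]_n) : Prop :=
  exists (c : R -> 'rV[R]_n) (e : R),
    [/\ 0 < e, geodesic M g `]- e, 1 + e[ c, c 0 = x, derive1 c 0 = v & c 1 = q].

Definition is_isometry (n : nat) (M : set 'rV[R]_n) (g : 'rV[R]_n -> 'M[R]_n)
    (phi : 'rV[R]_n -> 'rV[R]_n) : Prop :=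
  [/\ smooth_embedding M phi, phi @` M = M
    & forall c d, smooth_curve_in M c -> smooth_curve_in M d -> c 0 = d 0 ->
      bilin (g (phi (c 0))) (derive1 (phi \o c) 0) (derive1 (phi \o d) 0) =
      bilin (g (c 0)) (derive1 c 0) (derive1 d 0)].

Definition isometric_action (n : nat) (M : set 'rV[R]_n)
    (g : 'rV[R]_n -> 'M[R]_n) (G : topologicalGroupType)
    (act : G -> 'rV[R]_n -> 'rV[R]_n) : Prop :=
  [/\ {within [set: G] `*` M,
        continuous (fun p : G * 'rV[R]_n => act p.1 p.2)},
      forall x, M x -> act 1%g x = x,
      forall a b x, M x -> act (a * b)%g x = act a (act b x)
    & forall a, is_isometry M g (act a)].

End Riemannian.

Section Curves.
Context {R : realType}.

Definition jet (n : nat) (c : R -> 'rV[R]_n) :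
    prod_topology (fun _ : nat => {uniform R -> 'rV[R]_n}) :=
  fun k => derive1n k c.

(* Maps S^1 -> R^n are 2pi-periodic functions on R. On smooth periodic functions
   this topology is the C^infinity topology: uniform convergence of every
   derivative. *)
Definition curve (n : nat) : Type := initial_topology (@jet n).

HB.instance Definition _ (n : nat) :=
  Topological.copy (curve n) (initial_topology (@jet n)).

(* Emb^infinity(S^1, M). As S^1 is compact, the injective immersions are the
   embeddings. *)
Definition Emb (n : nat) (M : set 'rV[R]_n) : set (curve n) :=
  [set c | [/\ smooth_curve_in M c,
               forall t, c (t + 2 * pi) = c t,
               forall t, derive1 (c : R -> 'rV[R]_n) t != 0
             & forall s t, c s = c t -> exists k : int, t = s + k%:~R * (2 * pi)]].

Definition path_component (T : topologicalType) (A : set T) (x : T) : set T :=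
  [set y | exists p : R -> T,
    [/\ {within `[0, 1], continuous p}, forall t, `[0, 1] t -> A (p t),
        p 0 = x & p 1 = y]].

(* An oriented knot type in M is given by its path component of Emb^infinity. *)
Definition knot_component (n : nat) (M : set 'rV[R]_n) (E : set (curve n)) :
    Prop :=
  exists2 c, Emb M c & E = path_component (Emb M) c.

Definition Len (n : nat) (g : 'rV[R]_n -> 'M[R]_n) (c : R -> 'rV[R]_n) : R :=
  \int[lebesgue_measure]_(t in `[0, 2 * pi])
    Num.sqrt (bilin (g (c t)) (derive1 c t) (derive1 c t)).

(* The radius-r disc bundle of the normal bundle of the image of c, as a set of
   pairs (foot point, normal vector). *)
Definition normal_disc_bundle (n : nat) (M : set 'rV[R]_n)
    (g : 'rV[R]_n -> 'M[R]_n) (c : R -> 'rV[R]_n) (r : R) :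
    set ('rV[R]_n * 'rV[R]_n) :=
  [set p | exists t, [/\ p.1 = c t, tangent M (c t) p.2,
    bilin (g (c t)) p.2 (derive1 c t) = 0 & bilin (g (c t)) p.2 p.2 < r ^+ 2]].

(* By uniqueness of geodesics, E below is determined on the disc bundle: it is
   the normal exponential map. *)
Definition Thi (n : nat) (M : set 'rV[R]_n) (g : 'rV[R]_n -> 'M[R]_n)
    (c : R -> 'rV[R]_n) : R :=
  sup [set r | 0 < r /\ exists E : 'rV[R]_n * 'rV[R]_n -> 'rV[R]_n,
    (forall p, normal_disc_bundle M g c r p -> is_exp M g p.1 p.2 (E p)) /\
    smooth_embedding (normal_disc_bundle M g c r) E].

Definition Rop (n : nat) (M : set 'rV[R]_n) (g : 'rV[R]_n -> 'M[R]_n)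
    (c : R -> 'rV[R]_n) : R :=
  Len g c / Thi M g c.

End Curves.

Section HomotopyGroups.
Context {R : realType}.

Definition sphere (i : nat) : set 'rV[R]_i.+1 :=
  [set z | \sum_j z 0 j ^+ 2 = 1].

Definition sphere_base (i : nat) : 'rV[R]_i.+1 := delta_mx 0 0.

(* Maps (S^i, * ) -> (A, a), for A a subspace of T; a map on S^i is a function
   on R^(i+1) whose values outside S^i are irrelevant. *)
Definition based_map (T : topologicalType) (A : set T) (a : T) (i : nat)
    (F : 'rV[R]_i.+1 -> T) : Prop :=
  [/\ {within @sphere i, continuous F}, forall z, sphere z -> A (F z)
    & F (sphere_base i) = a].

Definition based_homotopic (T : topologicalType) (A : set T) (a : T) (i : nat)
    (F F' : 'rV[R]_i.+1 -> T) : Prop :=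
  [/\ based_map A a F, based_map A a F'
    & exists H : R * 'rV[R]_i.+1 -> T,
      [/\ {within `[0, 1] `*` @sphere i, continuous H},
          forall t z, `[0, 1] t -> sphere z -> A (H (t, z)),
          forall z, sphere z -> H (0, z) = F z /\ H (1, z) = F' z
        & forall t, `[0, 1] t -> H (t, sphere_base i) = a]].

(* The underlying set of pi_i(A, a): classes of based maps. *)
Definition homotopy_group (T : topologicalType) (A : set T) (a : T) (i : nat) :
    set (set ('rV[R]_i.+1 -> T)) :=
  [set alpha | exists2 F, based_map A a F & alpha = based_homotopic A a F].

(* h_* alpha, for h : S -> T with values in the subspace B and carrying the
   base point to b. *)
Definition induced_map (S T : topologicalType) (B : set T) (b : T) (i : nat)
    (h : S -> T) (alpha : set ('rV[R]_i.+1 -> S)) : set ('rV[R]_i.+1 -> T) :=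
  [set F' | exists2 F, alpha F & based_homotopic B b (h \o F) F'].

End HomotopyGroups.

Arguments homotopy_group R {T} A a i _.

Section Widths.
Context {R : realType} (n : nat) (M : set 'rV[R]_n) (g : 'rV[R]_n -> 'M[R]_n).

Local Open Scope ereal_scope.

Definition width (i : nat) (alpha : set ('rV[R]_i.+1 -> curve n)) : \bar R :=
  ereal_inf [set ereal_sup [set (Rop M g (F z))%:E | z in @sphere R i]
            | F in alpha].

Definition excess_width (i : nat) (c : curve n)
    (alpha : set ('rV[R]_i.+1 -> curve n)) : \bar R :=
  width alpha - (Rop M g c)%:E.

Definition stabilisation_level (i : nat) (E : set (curve n)) (c : curve n) :
    \bar R :=
  ereal_sup [set width alpha | alpha in homotopy_group R E c i].

End Widths.

Variant ambient_space := Euclidean3 | Sphere3.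

Definition ambient_dim (X : ambient_space) : nat :=
  match X with Euclidean3 => 3 | Sphere3 => 4 end.

Definition points (R : realType) (X : ambient_space) : set 'rV[R]_(ambient_dim X) :=
  match X with Euclidean3 => setT | Sphere3 => @sphere R 3 end.

Arguments points R X _ : clear implicits.

(* Main.v *)
(* An isometry phi of M preserves speeds, hence lengths. It also maps geodesics to
   geodesics: replacing a parametrisation p by phi^-1 o p leaves the metric
   coefficients, and so the Christoffel symbols, unchanged. Hence phi o E o d(phi^-1) is a normal
   exponential map of phi o c whenever E is one of c, the two curves have the same
   thickness, and Rop is constant on the orbit of gamma. The width of a class is at
   least Rop(gamma), because every representative passes through gamma; it is equal
   to Rop(gamma) as soon as one representative takes its values in the orbit. *)
Require Import Defs.
From mathcomp Require Import all_boot all_order all_algebra.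
From mathcomp Require Import all_classical all_reals all_analysis.

Set Implicit Arguments.
Unset Strict Implicit.
Unset Printing Implicit Defensive.

Import Order.TTheory GRing.Theory Num.Theory.
Import numFieldNormedType.Exports.

Local Open Scope ring_scope.
Local Open Scope classical_set_scope.

(** * C^k calculus *)

Section SmoothCalculus.
Context {R : realType}.
Implicit Types U V W Z : normedModType R.

(** The difference [g - f] vanishes near [x], hence is differentiable there with differential 0, and
    [g] is [f] plus that difference. *)
Lemma near_eq_differentiable V W (f g : V -> W) x :
  {near x, f =1 g} -> differentiable f x -> differentiable g x.
Proof.
move=> fg df; have gfE : g = f + (g - f) by apply/funext => y; rewrite !fctE addrC subrK.
rewrite gfE; apply: (differentiableD df).
set h := g - f.
have hx : h x = 0 by rewrite /h !fctE (nbhs_singleton fg) subrr.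
have ho : h \o shift x = cst (h x) + (0 : V -> W) +o_ 0 id.
  apply/eqaddoP => e e0; rewrite hx.
  have : \forall y \near 0, f (y + x) = g (y + x).
    have fg' : \forall y \near x, f y = g y by exact: fg.
    by rewrite (near_shift 0) subr0 in fg'.
  apply: filterS => y E.
  rewrite /h /= !fctE /= E subrr addr0 subr0 normr0.
  by apply: mulr_ge0 => //; exact: ltW.
have dh : 'd h x = 0 :> (V -> W).
  by apply: (@diff_unique _ _ _ h (\0 : {linear V -> W}) x) => //; apply: cst_continuous.
apply/diff_locallyP; rewrite dh; split=> //; exact: cst_continuous.
Qed.

(* L is a continuous linear map, in the form in which it is used: as a map equal
   to its own differential at every point. *)
Definition self_diff V W (L : V -> W) := forall x, is_diff x L L.

Lemma self_diff_differentiable V W (L : V -> W) x : self_diff L -> differentiable L x.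
Proof. by move=> dL; have := dL x => ?; exact: ex_diff. Qed.

Lemma self_diffE V W (L : V -> W) x v : self_diff L -> 'D_v L x = L v.
Proof.
move=> dL; have dLx := dL x.
by rewrite (deriveE _ (self_diff_differentiable x dL)) diff_val.
Qed.

Lemma self_diffZ V W (L : V -> W) a v : self_diff L -> L (a *: v) = a *: L v.
Proof.
move=> dL; have dL0 := self_diff_differentiable 0 dL.
by rewrite -!(self_diffE 0 _ dL) !(deriveE _ dL0) linearZ.
Qed.

Lemma self_diff_linear V W (L : {linear V -> W}) : continuous L -> self_diff L.
Proof. by move=> cL x; split; [exact: linear_differentiable|rewrite diff_lin]. Qed.

Lemma self_diff_fst V W : self_diff (@fst V W).
Proof. apply: self_diff_linear => x; exact: cvg_fst. Qed.

Lemma self_diff_snd V W : self_diff (@snd V W).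
Proof. apply: self_diff_linear => x; exact: cvg_snd. Qed.

Lemma self_diff_coord m n i j : self_diff (fun A : 'M[R]_(m, n) => A i j : R).
Proof.
move=> x; split; first exact: differentiable_coord.
apply/funext => v; rewrite -deriveE; last exact: differentiable_coord.
by rewrite -[RHS](congr1 (fun B : 'M[R]_(m, n) => B i j) (derive_id x v)) derive_mx ?mxE//.
Qed.

Lemma self_diff_scalel V (v : V) : self_diff (fun a : R => a *: v).
Proof. by move=> x; apply: is_diff_scalel. Qed.

Lemma self_diff_id V : self_diff (@id V).
Proof. by move=> x; apply: is_diff_id. Qed.

(** Using directional derivatives keeps every order among maps [V -> W], which allows induction on
    [k]. Level [k] asks for [k + 1] successive differentiations; the shift disappears when all [k]
    are taken together. *)
Fixpoint Ck (k : nat) V W (U : set V) (f : V -> W) : Prop :=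
  (forall x, U x -> differentiable f x) /\
  (if k is k'.+1 then forall v, Ck k' U ('D_v f) else True).

Lemma Ck_diff k V W (U : set V) (f : V -> W) x : Ck k U f -> U x -> differentiable f x.
Proof. by case: k => [|k] /= [+ _] Ux; apply. Qed.

Lemma Ck_derive k V W (U : set V) (f : V -> W) v : Ck k.+1 U f -> Ck k U ('D_v f).
Proof. by case=> _; apply. Qed.

Lemma CkS k V W (U : set V) (f : V -> W) : Ck k.+1 U f -> Ck k U f.
Proof.
elim: k f => [|k IH] f; first by case=> df _; split.
by move=> [df Df]; split=> // v; apply: IH; exact: Df.
Qed.

(** [Ck] peels off the innermost derivative, which is the last entry of the list in [smooth_at];
    hence [rcons] and induction from the end. *)
Lemma smooth_CkP V W (U : set V) (f : V -> W) :
  (forall x, U x -> smooth_at f x) <-> forall k, Ck k U f.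
Proof.
split=> [sf k|Cf x Ux s].
  elim: k f sf => [|k IH] f sf; first by split=> // x Ux; exact: (sf x Ux [::]).
  split=> [x Ux|v]; first exact: (sf x Ux [::]).
  by apply: IH => x Ux s; have := sf x Ux (rcons s v); rewrite foldr_rcons.
elim/last_ind: s f Cf => [|s v IH] f Cf; first exact: Ck_diff (Cf 0%N) Ux.
by rewrite foldr_rcons; apply: IH => k; exact: Ck_derive.
Qed.

(** * Sums, products and linear images of C^k maps on an open set *)

Section OnOpen.
Variables (V : normedModType R) (U : set V).
Hypothesis oU : open U.

Lemma near_open x (P : V -> Prop) : U x -> (forall y, U y -> P y) -> \forall y \near x, P y.
Proof. by move=> Ux UP; apply: filterS UP _; exact: open_nbhs_nbhs. Qed.

(** As [U] is open, equality on [U] is equality near each of its points, so it passes to directional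
    derivatives. *)
Lemma Ck_eq k W (f h : V -> W) : (forall x, U x -> f x = h x) -> Ck k U f -> Ck k U h.
Proof.
elim: k f h => [|k IH] f h fh; case=> df Df; split=> [x Ux|//].
- by apply: near_eq_differentiable (df x Ux); exact: near_open.
- by apply: near_eq_differentiable (df x Ux); exact: near_open.
- by move=> v; apply: IH (Df v) => x Ux; apply: near_eq_derive; exact: near_open.
Qed.

Lemma Ck_cst k W (w : W) : Ck k U (cst w : V -> W).
Proof.
elim: k w => [|k IH] w; split=> // v.
by apply: Ck_eq (IH 0) => x Ux; rewrite derive_cst.
Qed.

Lemma Ck_add k W (f h : V -> W) : Ck k U f -> Ck k U h -> Ck k U (f + h).
Proof.
elim: k f h => [|k IH] f h; case=> df Df [dh Dh]; split=> [x Ux|//].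
- by apply: differentiableD; [exact: df|exact: dh].
- by apply: differentiableD; [exact: df|exact: dh].
- move=> v; apply: Ck_eq (IH _ _ (Df v) (Dh v)) => x Ux.
  by rewrite deriveD //; apply: diff_derivable; [exact: df|exact: dh].
Qed.

Lemma Ck_sum k W n (f : 'I_n -> V -> W) :
  (forall i, Ck k U (f i)) -> Ck k U (\sum_i f i).
Proof.
move=> Cf; elim/big_ind: _ => //; first exact: Ck_cst.
by move=> a b; exact: Ck_add.
Qed.

(** A continuous linear map commutes with directional derivatives. *)
Lemma Ck_comp_self_diff k W Z (L : W -> Z) (f : V -> W) :
  self_diff L -> Ck k U f -> Ck k U (L \o f).
Proof.
move=> dL; have dLx x : differentiable L x by exact: self_diff_differentiable.
elim: k f => [|k IH] f; case=> df Df; split=> [x Ux|//].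
- by apply: differentiable_comp => //; exact: df.
- by apply: differentiable_comp => //; exact: df.
- move=> v; apply: Ck_eq (IH _ (Df v)) => x Ux /=.
  rewrite [RHS]deriveE; last by apply: differentiable_comp => //; exact: df.
  rewrite diff_comp //=; last exact: df.
  by rewrite -(deriveE v (df x Ux)) -(deriveE _ (dLx (f x))) (self_diffE _ _ dL).
Qed.

Lemma CkM k (f h : V -> R) : Ck k U f -> Ck k U h -> Ck k U (f * h).
Proof.
elim: k f h => [|k IH] f h.
  by case=> df Df [dh Dh]; split=> // x Ux; apply: differentiableM; [exact: df|exact: dh].
move=> Cf Ch; have [df Df] := Cf; have [dh Dh] := Ch; split=> [x Ux|v].
  by apply: differentiableM; [exact: df|exact: dh].
apply: (Ck_eq (f := f * 'D_v h + h * 'D_v f)).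
  by move=> x Ux; rewrite deriveM //; apply: diff_derivable; [exact: df|exact: dh].
by apply: Ck_add; apply: IH; first [exact: CkS|exact: Ck_derive].
Qed.

End OnOpen.

(* A finite basis with continuous coordinates: V is finite-dimensional. *)
Record coords V := Coords {
  coords_dim : nat;
  coords_basis : 'I_coords_dim -> V;
  coords_fun : 'I_coords_dim -> V -> R;
  coords_diff : forall i, self_diff (coords_fun i);
  coordsE : forall v, v = \sum_i coords_fun i v *: coords_basis i }.

Arguments coords_basis [V] c _.
Arguments coords_fun [V] c _ _.
Arguments coords_diff [V] c _ _.
Arguments coordsE [V] c _.

Lemma Ck_coords (V W : normedModType R) (B : coords W) (U : set V) k (f : V -> W) :
  open U -> (forall i, Ck k U (coords_fun B i \o f)) -> Ck k U f.
Proof.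
pose fi i x := coords_fun B i (f x) *: coords_basis B i.
move=> oU Cf; apply: (Ck_eq oU (f := \sum_i fi i)) => //.
  by move=> x _; rewrite fct_sumE [RHS](coordsE B).
apply: Ck_sum => // i.
apply: (@Ck_comp_self_diff V U oU _ _ _ (fun a : R => a *: coords_basis B i)).
  exact: self_diff_scalel.
exact: Cf.
Qed.

Lemma CkZ (V W : normedModType R) (B : coords W) (U : set V) k (a : V -> R) (f : V -> W) :
  open U -> Ck k U a -> Ck k U f -> Ck k U (fun x => a x *: f x).
Proof.
move=> oU Ca Cf; apply: (Ck_coords (B := B)) => // i.
have -> : coords_fun B i \o (fun x => a x *: f x) = a * (coords_fun B i \o f).
  apply/funext => x /=; rewrite !fctE /=.
  exact/self_diffZ/coords_diff.
by apply: CkM => //; apply: Ck_comp_self_diff => //; exact: coords_diff.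
Qed.

(** In the chain rule [h] is differentiated in the direction ['D_v f x], which varies with [x].
    Expanding it in the basis of [W] leaves derivatives of [h] along fixed vectors, weighted by the
    coordinates of ['D_v f], and the induction applies to these. *)
Lemma Ck_comp (V W Z : normedModType R) (B : coords W) (B' : coords Z)
    (U : set V) (U' : set W) k (f : V -> W) (h : W -> Z) :
  open U -> open U' -> (forall x, U x -> U' (f x)) ->
  Ck k U f -> Ck k U' h -> Ck k U (h \o f).
Proof.
move=> oU oU' UU'; elim: k h => [|k IH] h Cf Ch.
  split=> // x Ux; apply: differentiable_comp; first exact: Ck_diff Cf Ux.
  by apply: Ck_diff Ch _; exact: UU'.
have df x : U x -> differentiable f x by move=> Ux; exact: Ck_diff Cf Ux.
have dh x : U x -> differentiable h (f x) by move=> Ux; apply: Ck_diff Ch _; exact: UU'.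
split=> [x Ux|v]; first by apply: differentiable_comp; [exact: df|exact: dh].
pose hi i x := coords_fun B i ('D_v f x) *: ('D_(coords_basis B i) h \o f) x.
apply: (Ck_eq oU (f := \sum_i hi i)) => //.
  move=> x Ux; rewrite fct_sumE.
  rewrite [RHS](deriveE _ (differentiable_comp (df _ Ux) (dh _ Ux))).
  rewrite (diff_comp (df _ Ux) (dh _ Ux)) /=.
  rewrite -(deriveE _ (df _ Ux)) [in RHS](coordsE B ('D_v f x)) linear_sum.
  by apply: eq_bigr => i _; rewrite linearZ /= -(deriveE _ (dh _ Ux)).
apply: Ck_sum => // i; apply: (CkZ B') => //.
  by apply: Ck_comp_self_diff => //; [exact: coords_diff|exact: Ck_derive].
by apply: IH; [exact: CkS|exact: Ck_derive].
Qed.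

Lemma self_diff_comp V W Z (L : V -> W) (L' : W -> Z) :
  self_diff L -> self_diff L' -> self_diff (L' \o L).
Proof. by move=> dL dL' x; have dLx := dL x; have dLx' := dL' (L x); exact: is_diff_comp. Qed.

Lemma self_diff_inl V W : self_diff (fun u : V => (u, 0 : W)).
Proof. by move=> x; apply: (is_diff_eq (is_diff_pair (is_diff_id x) (is_diff_cst (0 : W) x))). Qed.

Lemma self_diff_inr V W : self_diff (fun u : W => (0 : V, u)).
Proof. by move=> x; apply: (is_diff_eq (is_diff_pair (is_diff_cst (0 : V) x) (is_diff_id x))). Qed.

Lemma Ck_of_self_diff V W (U : set V) k (L : V -> W) : open U -> self_diff L -> Ck k U L.
Proof.
move=> oU dL; have dLx x : differentiable L x by exact: self_diff_differentiable.
case: k => [|k]; split=> // v.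
by apply: Ck_eq (Ck_cst oU k (L v)) => // x Ux; rewrite self_diffE.
Qed.

(** The pair is the sum of [f] and [h] followed by the two linear injections into the product. *)
Lemma Ck_pair V W Z (U : set V) k (f : V -> W) (h : V -> Z) :
  open U -> Ck k U f -> Ck k U h -> Ck k U (fun x => (f x, h x)).
Proof.
move=> oU Cf Ch.
have := Ck_add oU (Ck_comp_self_diff oU (@self_diff_inl W Z) Cf)
  (Ck_comp_self_diff oU (@self_diff_inr W Z) Ch).
by apply: Ck_eq => // x _; rewrite !fctE /=; congr pair; rewrite ?addr0 ?add0r.
Qed.

Definition coords_rV n : coords 'rV[R]_n.
Proof.
apply: (@Coords _ n (fun i => delta_mx 0 i) (fun i v => v 0 i)) => [i|v].
  exact: self_diff_coord.
by rewrite [LHS]row_sum_delta.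
Defined.

Definition coords_prod V W : coords V -> coords W -> coords (V * W)%type.
Proof.
move=> B B'.
refine (@Coords (V * W)%type (coords_dim B + coords_dim B')
  (fun i => match fintype.split i with
            | inl j => (coords_basis B j, 0)
            | inr j => (0, coords_basis B' j)
            end)
  (fun i p => match fintype.split i with
              | inl j => coords_fun B j p.1
              | inr j => coords_fun B' j p.2
              end) _ _).
  move=> i; case: (fintype.split i) => j.
    by apply: self_diff_comp; [exact: self_diff_fst|exact: coords_diff].
  by apply: self_diff_comp; [exact: self_diff_snd|exact: coords_diff].
move=> [v w]; rewrite big_split_ord /=.
under eq_bigr => i _ do rewrite (unsplitK (inl i)).
under [X in _ + X]eq_bigr => i _ do rewrite (unsplitK (inr i)).
apply: injective_projections => /=.
  rewrite !raddf_sum /= [X in _ + X]big1 ?addr0; last by move=> i _; rewrite scaler0.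
  exact: coordsE.
rewrite !raddf_sum /= [X in X + _]big1 ?add0r; last by move=> i _; rewrite scaler0.
exact: coordsE.
Defined.

End SmoothCalculus.

(** * Smooth maps on subsets and their differentials *)

Section SmoothOn.
Context {R : realType}.
Implicit Types U V W Z : normedModType R.

Lemma smooth_at_continuous V W (f : V -> W) x : smooth_at f x -> {for x, continuous f}.
Proof. by move=> /(_ [::]); exact: differentiable_continuous. Qed.

Lemma Ck_smooth_on V W (A U : set V) (F f : V -> W) :
  open U -> A `<=` U -> (forall k, Ck k U F) -> (forall x, A x -> F x = f x) ->
  smooth_on A f.
Proof.
move=> oU AU CF Ff x Ax; exists U, F; split=> //; first exact: AU.
  by apply/smooth_CkP.
by move=> y _; exact: Ff.
Qed.

Lemma smooth_onS V W (A B : set V) (f : V -> W) : A `<=` B -> smooth_on B f -> smooth_on A f.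
Proof.
move=> AB sf x Ax; have [U [F [oU Ux sF Ff]]] := sf x (AB x Ax).
by exists U, F; split=> // y Uy Ay; apply: Ff => //; exact: AB.
Qed.

(** Near a point of the open set [A], the map [f] coincides with its smooth extension, and so do all
    derivatives. *)
Lemma smooth_on_open V W (A : set V) (f : V -> W) :
  open A -> smooth_on A f -> forall x, A x -> smooth_at f x.
Proof.
move=> oA sf x Ax; have [U [F [oU Ux sF Ff]]] := sf x Ax.
have oUA : open (U `&` A) by exact: openI.
have /smooth_CkP : forall k, Ck k (U `&` A) f; last by apply.
move=> k; apply: (Ck_eq oUA (f := F)); first by move=> y [Uy Ay]; exact: Ff.
by move: k; apply/smooth_CkP => y [Uy _]; exact: sF.
Qed.

Lemma smooth_on_comp V W Z (B : coords W) (B' : coords Z) (A : set V) (A' : set W)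
    (f : V -> W) (h : W -> Z) :
  (forall x, A x -> A' (f x)) -> smooth_on A f -> smooth_on A' h -> smooth_on A (h \o f).
Proof.
move=> AA' sf sh x Ax.
have [U [F [oU Ux sF Ff]]] := sf x Ax.
have [U' [H [oU' U'x sH Hh]]] := sh _ (AA' x Ax).
(* The extensions [F] and [H] compose only where [F] lands in [U']; this set is open because [F] is
   continuous on [U]. *)
have oW : open (U `&` F @^-1` U').
  rewrite openE => y [Uy U'y]; apply: filterI; first exact: open_nbhs_nbhs.
  by apply: (smooth_at_continuous (sF y Uy)); exact: open_nbhs_nbhs.
exists (U `&` F @^-1` U'), (H \o F); split=> //.
- by split=> //; rewrite /preimage /= Ff.
- apply/smooth_CkP => k; apply: (Ck_comp B B' oW oU') => [y [] //||].
    by move: k; apply/smooth_CkP => y [Uy _]; exact: sF.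
  by move: k; apply/smooth_CkP.
- by move=> y [Uy U'y] Ay /=; rewrite Ff// Hh//; [rewrite -Ff|exact: AA'].
Qed.

Definition coords_R : coords R.
Proof.
apply: (@Coords _ R 1 (fun=> 1) (fun _ x => x)) => [_|v]; first exact: self_diff_id.
by rewrite big_ord1 /GRing.scale /= mulr1.
Defined.

(** Each function is the derivative of the other up to sign, so the induction treats both at
    once. *)
Lemma Ck_sin_cos k : Ck k [set: R] (sin : R -> R) /\ Ck k [set: R] (cos : R -> R).
Proof.
have ds (x : R) : differentiable (sin : R -> R) x by apply/derivable1_diffP; exact: ex_derive.
have dc (x : R) : differentiable (cos : R -> R) x by apply/derivable1_diffP; exact: ex_derive.
elim: k => [|k [IHs IHc]]; first by split; split.
split; split=> // v.
  apply: (Ck_eq openT _ (Ck_comp_self_diff openT (self_diff_scalel v) IHc)) => x _ /=.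
  rewrite deriveE // -[v in RHS]mulr1 linearZ /= -deriveE //.
  rewrite (@derive_val _ _ _ _ _ _ _ (is_derive_sin x)).
  by rewrite /GRing.scale /= mulrC.
apply: (Ck_eq openT _ (Ck_comp_self_diff openT (self_diff_scalel (- v)) IHs)) => x _ /=.
rewrite deriveE // -[v in RHS]mulr1 linearZ /= -deriveE //.
rewrite (@derive_val _ _ _ _ _ _ _ (is_derive_cos x)).
by rewrite /GRing.scale /= mulrN mulrN mulrC.
Qed.

End SmoothOn.

(** * Tangent vectors and the differential of a map defined on a subset *)

Section Differential.
Context {R : realType} (n : nat).
Implicit Types (M : set 'rV[R]_n) (phi psi : 'rV[R]_n -> 'rV[R]_n).

(* The curve x + c sin(t / c) e, for small c > 0, is defined for all t, stays near
   x, and has velocity e at 0; tangent vectors are velocities of such global curves. *)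
Lemma smooth_line_in (V : normedModType R) (A : set V) (x e : V) : open A -> A x ->
  exists a : R -> V, [/\ forall k, Ck k setT a, forall s, A (a s), a 0 = x & 'D_1 a 0 = e].
Proof.
move=> oA Ax.
have /nbhs_ballP[d /= d0 dA] : nbhs x A by exact: open_nbhs_nbhs.
have e1 : 0 < `|e| + 1 by rewrite ltr_wpDl.
(* The displacement is at most [c] times the norm of [e], which is less than [d]; adding 1 keeps the
   denominator positive when [e] is 0. *)
pose c := d / (`|e| + 1).
have c0 : 0 < c by rewrite divr_gt0.
pose L1 : R -> R := fun s => s *: c^-1.
pose L2 : R -> V := fun s => s *: (c *: e).
have dL1 : self_diff L1 by exact: self_diff_scalel.
have dL2 : self_diff L2 by exact: self_diff_scalel.
have Cb k : Ck k setT (L2 \o (sin \o L1)).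
  apply: (Ck_comp_self_diff openT dL2); apply: (Ck_comp coords_R coords_R openT openT) => //.
    exact: (Ck_of_self_diff _ openT).
  by have [] := @Ck_sin_cos R k.
pose a : R -> V := cst x + (L2 \o (sin \o L1)).
have L10 : L1 0 = 0 by rewrite /L1 scale0r.
exists a; split.
- by move=> k; exact: (Ck_add openT (Ck_cst openT k x) (Cb k)).
- move=> s; apply: dA; rewrite -ball_normE /= /a !fctE /= opprD addrA subrr add0r normrN.
  rewrite /L2 2!normrZ (gtr0_norm c0) /c.
  apply: (@le_lt_trans _ _ (d / (`|e| + 1) * `|e|)).
    rewrite ler_piMl ?mulr_ge0 ?divr_ge0 ?(ltW d0) ?(ltW e1)//.
    by rewrite ler_norml sin_le1 sin_geN1.
  by rewrite mulrAC ltr_pdivrMr// ltr_pM2l// ltrDl.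
- by rewrite /a !fctE /= L10 sin0 /L2 scale0r addr0.
- have db : differentiable (L2 \o (sin \o L1)) 0 by apply: (Ck_diff (Cb 0%N)).
  rewrite /a deriveD; [|exact: derivable_cst|exact: diff_derivable].
  rewrite derive_cst add0r.
  have ds (y : R) : differentiable (sin : R -> R) y by apply/derivable1_diffP; exact: ex_derive.
  have dd : differentiable (sin \o L1) 0.
    by apply: differentiable_comp => //; exact: self_diff_differentiable.
  have dL2x (y : R) : differentiable L2 y by exact: self_diff_differentiable.
  have dL1x (y : R) : differentiable L1 y by exact: self_diff_differentiable.
  have Ds : is_derive (0 : R) 1 (sin \o L1) (cos (L1 0) * c^-1).
    apply: is_derive1_comp; apply: DeriveDef; first exact: diff_derivable.
    by rewrite (self_diffE _ _ dL1) /L1 scale1r.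
  rewrite (deriveE _ (differentiable_comp dd (dL2x _))) (diff_comp dd (dL2x _)) /=.
  rewrite -(deriveE _ dd) -(deriveE _ (dL2x _)) (self_diffE _ _ dL2) derive_val.
  by rewrite L10 cos0 mul1r /L2 scalerA mulVf ?scale1r ?gt_eqF.
Qed.

(** Apply [h] to a global curve in [A] through [x] with velocity [e]. *)
Lemma tangent_derive (V : normedModType R) (B : coords V) (M : set 'rV[R]_n)
    (A : set V) (h : V -> 'rV[R]_n) x e :
  open A -> smooth_on A h -> (forall y, A y -> M (h y)) -> A x ->
  tangent M (h x) ('D_e h x).
Proof.
move=> oA sh hM Ax; have [a [Ca aA a0 a1]] := smooth_line_in e oA Ax.
exists (h \o a); split.
- split=> [|t]; last exact/hM/aA.
  apply: (smooth_on_comp B (coords_rV n) (A' := A)) => //.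
  by apply: (Ck_smooth_on openT _ Ca).
- by rewrite /= a0.
- have dh : differentiable h (a 0) by rewrite a0; exact: (smooth_on_open oA sh Ax [::]).
  have da : differentiable a 0 by exact: (Ck_diff (Ca 0%N)).
  have dha := differentiable_comp da dh.
  rewrite derive1E (deriveE _ dha) (diff_comp da dh) /= -(deriveE _ da) a1.
  by rewrite -(deriveE _ dh) a0.
Qed.

(* The differential of phi along M at x; only its values on [tangent M x] matter. *)
Definition dmap M phi (x v : 'rV[R]_n) : 'rV[R]_n :=
  xget 0 [set w | exists c, [/\ smooth_curve_in M c, c 0 = x, derive1 c 0 = v
                              & derive1 (phi \o c) 0 = w]].

(** [phi] itself may fail to be differentiable in the ambient space, but [h] takes values in [M], so
    [phi \o h] and [F \o h] agree near [x]. *)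
Lemma derive_comp_extension (V : normedModType R) (M U : set 'rV[R]_n) (A : set V)
    (phi F : 'rV[R]_n -> 'rV[R]_n) (h : V -> 'rV[R]_n) x e :
  open U -> differentiable F (h x) -> (forall y, U y -> M y -> F y = phi y) ->
  open A -> smooth_on A h -> (forall y, A y -> M (h y)) -> A x -> U (h x) ->
  'D_e (phi \o h) x = 'd F (h x) ('D_e h x).
Proof.
move=> oU dF Fphi oA sh hM Ax Ux.
have sx := smooth_on_open oA sh Ax.
have dh : differentiable h x by exact: (sx [::]).
rewrite (near_eq_derive (g := F \o h)).
  rewrite (deriveE _ (differentiable_comp dh dF)) (diff_comp dh dF) /=.
  by rewrite (deriveE _ dh).
have nU : \forall y \near x, U (h y) by apply: (smooth_at_continuous sx); exact: open_nbhs_nbhs.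
have nA : \forall y \near x, A y by exact: open_nbhs_nbhs.
by near=> y; rewrite /= Fphi//; [near: y|apply: hM; near: y].
Unshelve. all: by end_near. Qed.

Lemma dmapE M phi (U : set 'rV[R]_n) F x v :
  open U -> U x -> differentiable F x -> (forall y, U y -> M y -> F y = phi y) ->
  tangent M x v -> dmap M phi x v = 'd F x v.
Proof.
move=> oU Ux dF Fphi [c [[sc cM] c0 c1]]; rewrite /dmap.
(* The default value of [xget] is excluded by the curve witnessing tangency of [v]. Whichever curve
   is chosen, the chain rule for [F] gives the same vector, so the choice is harmless. *)
case: xgetP => [w _ [c' [[sc' c'M] c'0 c'1 <-]]|/(_ (derive1 (phi \o c) 0)) /=]; last first.
  by case; exists c; split.
have dFc : differentiable F (c' 0) by rewrite c'0.
have Uc : U (c' 0) by rewrite c'0.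
rewrite derive1E (derive_comp_extension (1 : R) oU dFc Fphi openT sc' (fun y _ => c'M y) I Uc).
by rewrite -derive1E c'1 c'0.
Qed.

Lemma derive_comp_dmap (V : normedModType R) (B : coords V) M (A : set V)
    phi (h : V -> 'rV[R]_n) x e :
  smooth_on M phi -> open A -> smooth_on A h -> (forall y, A y -> M (h y)) -> A x ->
  'D_e (phi \o h) x = dmap M phi (h x) ('D_e h x).
Proof.
move=> sphi oA sh hM Ax.
have [U [F [oU Ux sF Ff]]] := sphi _ (hM _ Ax).
have dF : differentiable F (h x) by exact: (sF _ Ux [::]).
rewrite (derive_comp_extension e oU dF Ff oA sh hM Ax Ux).
by rewrite (dmapE oU Ux dF Ff)//; exact: (tangent_derive B e oA sh hM Ax).
Qed.

Lemma derive1_comp_dmap M phi (c : R -> 'rV[R]_n) t :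
  smooth_on M phi -> smooth_curve_in M c ->
  derive1 (phi \o c) t = dmap M phi (c t) (derive1 c t).
Proof.
move=> sphi [sc cM]; rewrite !derive1E.
exact: (derive_comp_dmap coords_R (1 : R) sphi openT sc (fun y _ => cM y) I).
Qed.

Definition tangent_map M phi (p : 'rV[R]_n * 'rV[R]_n) : 'rV[R]_n * 'rV[R]_n :=
  (phi p.1, dmap M phi p.1 p.2).

Definition tangent_bundle M : set ('rV[R]_n * 'rV[R]_n) :=
  [set p | M p.1 /\ tangent M p.1 p.2].

(** [dmap] is defined by choice, so smoothness is read off a local extension [F]: on tangent vectors
    [dmap] agrees with the sum of the [v_i] times the partial derivatives of [F], which is smooth in
    point and vector jointly. *)
Lemma smooth_tangent_map M phi :
  smooth_on M phi -> smooth_on (tangent_bundle M) (tangent_map M phi).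
Proof.
move=> sphi [x v] [/= Mx tv].
have [U [F [oU Ux sF Ff]]] := sphi _ Mx.
have oU' : open ((fst : 'rV[R]_n * 'rV[R]_n -> 'rV[R]_n) @^-1` U).
  by apply: open_comp => // y _; exact: cvg_fst.
pose dF (p : 'rV[R]_n * 'rV[R]_n) := \sum_(i < n) (p.2 0 i *: 'D_(delta_mx 0 i) F p.1).
exists (fst @^-1` U), (fun p => (F p.1, dF p)); split=> //.
  apply/smooth_CkP => k.
  have CF j : Ck j U F by move: j; apply/smooth_CkP.
  have Cf : Ck k (fst @^-1` U) (fst : 'rV[R]_n * 'rV[R]_n -> 'rV[R]_n).
    exact: (Ck_of_self_diff _ oU' (@self_diff_fst _ _ _)).
  apply: (Ck_pair oU').
    exact: (Ck_comp (coords_rV n) (coords_rV n) oU' oU _ Cf (CF k)).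
  rewrite (_ : dF = \sum_(i < n) (fun p : 'rV[R]_n * 'rV[R]_n =>
      p.2 0 i *: ('D_(delta_mx 0 i) F \o fst) p)); last first.
    by apply/funext => p; rewrite fct_sumE.
  apply: (Ck_sum oU') => i; apply: (CkZ (coords_rV n) oU').
    apply: (Ck_of_self_diff _ oU'); apply: (self_diff_comp (L' := fun w : 'rV[R]_n => w 0 i)).
      exact: self_diff_snd.
    exact: self_diff_coord.
  apply: (Ck_comp (coords_rV n) (coords_rV n) oU' oU _ Cf) => //.
  exact/Ck_derive/CF.
move=> [y w] /= Uy [/= My tw]; rewrite /tangent_map /= Ff//; congr pair.
have dFy : differentiable F y by exact: (sF _ Uy [::]).
rewrite (dmapE oU Uy dFy)// /dF /= [in RHS](row_sum_delta w) linear_sum.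
by apply: eq_bigr => i _; rewrite linearZ /= -deriveE.
Qed.

Lemma tangent_dmap M phi x v :
  smooth_on M phi -> (forall y, M y -> M (phi y)) -> tangent M x v ->
  tangent M (phi x) (dmap M phi x v).
Proof.
move=> sphi phiM [c [[sc cM] c0 c1]]; exists (phi \o c); split.
- split=> [|t]; last exact/phiM/cM.
  exact: (smooth_on_comp (coords_rV n) (coords_rV n) (A' := M)).
- by rewrite /= c0.
- by rewrite (derive1_comp_dmap _ sphi)// c0 c1.
Qed.

(** For a curve [c] in [M] with velocity [v], the curve [psi \o (phi \o c)] is [c] itself; apply the
    chain rule twice. *)
Lemma dmapK M phi psi x v :
  smooth_on M phi -> (forall y, M y -> M (phi y)) -> smooth_on M psi ->
  (forall y, M y -> psi (phi y) = y) -> tangent M x v ->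
  dmap M psi (phi x) (dmap M phi x v) = v.
Proof.
move=> sphi phiM spsi psiK [c [[sc cM] c0 c1]].
have spc : smooth_curve_in M (phi \o c).
  split=> [|t]; last exact/phiM/cM.
  exact: (smooth_on_comp (coords_rV n) (coords_rV n) (A' := M)).
have := derive1_comp_dmap 0 spsi spc.
rewrite (derive1_comp_dmap 0 sphi (conj sc cM)) /= c0 c1 => <-.
have -> : psi \o (phi \o c) = c by apply/funext => t /=; rewrite psiK.
exact: c1.
Qed.

Lemma isometry_dmap M g phi x u v : is_isometry M g phi ->
  tangent M x u -> tangent M x v ->
  bilin (g (phi x)) (dmap M phi x u) (dmap M phi x v) = bilin (g x) u v.
Proof.
move=> [[sphi _] _ iphi] [c [sc c0 c1]] [d [sd d0 d1]].
have := iphi c d sc sd; rewrite c0 d0 => /(_ erefl).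
rewrite (derive1_comp_dmap 0 sphi sc) (derive1_comp_dmap 0 sphi sd).
by rewrite c0 d0 c1 d1.
Qed.

End Differential.

(** * Isometries, geodesics and ropelength *)

Section Isometries.
Context {R : realType} (n : nat) (M : set 'rV[R]_n) (g : 'rV[R]_n -> 'M[R]_n).
Variables phi psi : 'rV[R]_n -> 'rV[R]_n.
Hypotheses (iphi : is_isometry M g phi) (ipsi : is_isometry M g psi).
Hypothesis phiK : forall x, M x -> psi (phi x) = x.
Hypothesis psiK : forall x, M x -> phi (psi x) = x.

Let sphi : smooth_on M phi. Proof. by have [[]] := iphi. Qed.
Let spsi : smooth_on M psi. Proof. by have [[]] := ipsi. Qed.
Let phiM x : M x -> M (phi x).
Proof. by move=> Mx; have [_ <- _] := iphi; exists x. Qed.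
Let psiM x : M x -> M (psi x).
Proof. by move=> Mx; have [_ <- _] := ipsi; exists x. Qed.

Lemma local_param_comp (U : set 'rV[R]_3) p : local_param M U p -> local_param M U (psi \o p).
Proof.
move=> [oU [sp [p' [sp' p'K]]] [V [oV pU]]].
have pM y : U y -> M (p y).
  by move=> Uy; have : (p @` U) (p y) by [exists y]; rewrite pU => -[].
split=> //.
  split; first exact: (smooth_on_comp (coords_rV n) (coords_rV n) pM sp spsi).
  exists (p' \o phi); split; last by move=> y Uy /=; rewrite psiK ?p'K//; exact: pM.
  apply: (smooth_on_comp (coords_rV n) (coords_rV 3) (A' := p @` U)) => //.
    by move=> _ [y Uy <-] /=; exists y => //; rewrite psiK//; exact: pM.
  by apply: smooth_onS sphi => _ [y Uy <-] /=; exact/psiM/pM.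
(* The image of [psi \o p] is the part of [M] that [phi] sends into [V]. Nothing is known of [phi]
   off [M], so the condition is imposed on [M] only; points of the image are interior because [phi]
   has a continuous extension near them. *)
exists (interior [set z | M z -> V (phi z)]); split; first exact: open_interior.
apply/seteqP; split=> [_ [y Uy <-]|z [Mz /interior_subset Vz]] /=.
  have [pMy Vpy] : (M `&` V) (p y) by rewrite -pU; exists y.
  split; first exact: psiM.
  have [A [F [oA Ax sF Ff]]] := sphi (psiM pMy).
  have VF : \forall z \near psi (p y), V (F z).
    apply: (smooth_at_continuous (sF _ Ax)); apply: open_nbhs_nbhs; split => //.
    by rewrite Ff ?psiK//; exact: psiM.
  have nA : \forall z \near psi (p y), A z by exact: open_nbhs_nbhs.
  by rewrite /interior /=; near=> z => Mz; rewrite -Ff//; near: z.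
have [y Uy py] : (p @` U) (phi z) by rewrite pU; split; [exact: phiM|exact: Vz].
by exists y => //=; rewrite py phiK.
Unshelve. all: by end_near. Qed.

Lemma pullback_comp (U : set 'rV[R]_3) p y : local_param M U p -> U y ->
  pullback g (psi \o p) y = pullback g p y.
Proof.
move=> [oU [sp _] [V [oV pU]]] Uy.
have pM z : U z -> M (p z).
  by move=> Uz; have : (p @` U) (p z) by [exists z]; rewrite pU => -[].
have tp e : tangent M (p y) ('D_e p y).
  exact: (tangent_derive (coords_rV 3) e oU sp pM Uy).
apply/matrixP => i j; rewrite !mxE.
rewrite !(derive_comp_dmap (coords_rV 3) _ spsi oU sp pM Uy).
exact: (isometry_dmap ipsi).
Qed.

(** Christoffel symbols involve first derivatives of the metric coefficients, so agreement on a
    neighbourhood is what is required. *)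
Lemma eq_christoffel (U : set 'rV[R]_3) (h h' : 'rV[R]_3 -> 'M[R]_3) k i j y :
  open U -> U y -> (forall z, U z -> h z = h' z) ->
  christoffel h k i j y = christoffel h' k i j y.
Proof.
move=> oU Uy hh'.
have E l m : \forall z \near y, h z l m = h' z l m.
  by apply: (near_open oU Uy) => z Uz; rewrite hh'.
rewrite /christoffel hh' //; apply: (f_equal (fun z => 2^-1 * z)); apply: eq_bigr => l _.
by rewrite (near_eq_derive _ (E j l)) (near_eq_derive _ (E i l)) (near_eq_derive _ (E i j)).
Qed.

(** A coordinate expression of [phi \o c] in [p] is one of [c] in [psi \o p], and the two
    parametrisations have the same Christoffel symbols, so the two geodesic equations are identical.
    Openness of [J] keeps [c] in [M] near [t], where [psi] undoes [phi]. *)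
Lemma geodesic_comp (J : set R) c : open J -> geodesic M g J c -> geodesic M g J (phi \o c).
Proof.
move=> oJ [sc cM gc]; split.
- exact: (smooth_on_comp (coords_rV n) (coords_rV n) cM sc sphi).
- by move=> t Jt; exact/phiM/cM.
move=> U p lp y t Jt yt k.
have lpU := lp; have [oU _ _] := lpU.
have [Uyt _] := nbhs_singleton yt.
have ypsi : \forall s \near t, U (y s) /\ (psi \o p) (y s) = c s.
  have nJ : \forall s \near t, J s by exact: open_nbhs_nbhs.
  near=> s; have [] : U (y s) /\ p (y s) = (phi \o c) s by near: s.
  by move=> Uy /= ->; split=> //; rewrite phiK//; apply: cM; near: s.
have chE i j : christoffel (pullback g p) k i j (y t) =
    christoffel (pullback g (psi \o p)) k i j (y t).
  by apply: (eq_christoffel _ _ _ oU Uyt) => z Uz; apply/esym/(pullback_comp lp).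
apply: (etrans _ (gc _ _ (local_param_comp lp) y t Jt ypsi k)).
apply: (f_equal (fun z => (derive1n 2 y t) 0 k + z)).
by apply: eq_bigr => i _; apply: eq_bigr => j _; rewrite chE.
Unshelve. all: by end_near. Qed.

Lemma is_exp_comp x v q : tangent M x v -> is_exp M g x v q ->
  is_exp M g (phi x) (dmap M phi x v) (phi q).
Proof.
move=> tv [c [e [e0 gc c0 c1 cq]]]; exists (phi \o c), e.
have oJ : open (`]- e, 1 + e[ : set R) by exact: itv_open.
have [sc cM _] := gc.
split=> //=; [exact: geodesic_comp|by rewrite c0| |by rewrite cq].
(* [c] is known to be smooth and to lie in [M] only on the open interval, so the chain rule is used
   there; 0 belongs to it. *)
rewrite derive1E (derive_comp_dmap coords_R (1 : R) sphi oJ sc cM); last first.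
  by rewrite /= in_itv /= oppr_lt0 e0 ltr_wpDl.
by rewrite -derive1E c0 c1.
Qed.

Lemma is_exp_in x v q : is_exp M g x v q -> M q.
Proof.
move=> [c [e [e0 [_ cM _] _ _ <-]]]; apply: cM.
by rewrite /= in_itv /= ltrDl e0 andbT (lt_trans _ ltr01)// oppr_lt0.
Qed.

End Isometries.

(** * Invariance of length, thickness and ropelength *)

Section Ropelength.
Context {R : realType} (n : nat) (M : set 'rV[R]_n) (g : 'rV[R]_n -> 'M[R]_n).

Lemma smooth_curve_in_comp phi c : is_isometry M g phi -> smooth_curve_in M c ->
  smooth_curve_in M (phi \o c).
Proof.
move=> [[sphi _] phiM _] [sc cM]; split=> [|t].
  by apply: (smooth_on_comp (coords_rV n) (coords_rV n) (A' := M)).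
by rewrite -phiM; exists (c t).
Qed.

Lemma Len_comp phi c : is_isometry M g phi -> smooth_curve_in M c ->
  Len g (phi \o c) = Len g c.
Proof.
move=> iphi sc; rewrite /Len; apply: eq_Rintegral => t _.
have [[sphi _] _ _] := iphi.
have tc : tangent M (c t) (derive1 c t).
  have [sc1 cM] := sc; rewrite derive1E.
  exact: (tangent_derive coords_R (1 : R) openT sc1 (fun y _ => cM y) I).
by rewrite (derive1_comp_dmap t sphi sc) /= (isometry_dmap iphi).
Qed.

Section Thickness.
Variables phi psi : 'rV[R]_n -> 'rV[R]_n.
Hypotheses (iphi : is_isometry M g phi) (ipsi : is_isometry M g psi).
Hypothesis phiK : forall x, M x -> psi (phi x) = x.
Hypothesis psiK : forall x, M x -> phi (psi x) = x.
Variables (c : R -> 'rV[R]_n).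
Hypothesis (sc : smooth_curve_in M c).

Lemma normal_disc_bundle_tangent d r : normal_disc_bundle M g d r `<=` tangent_bundle M.
Proof.
by move=> [x v] [t [/= -> tv _ _]]; split=> //=; have [e [[_ eM] <- _]] := tv.
Qed.

(** The differential of [psi] preserves inner products and carries the velocity of [phi \o c] to
    that of [c], so orthogonality and the norm bound survive. *)
Lemma tangent_map_normal_disc_bundle r p :
  normal_disc_bundle M g (phi \o c) r p ->
  normal_disc_bundle M g c r (tangent_map M psi p).
Proof.
move=> [t [p1 tv no le]].
have [[sphi _] _ _] := iphi; have [[spsi _] psiM _] := ipsi.
have spc := smooth_curve_in_comp iphi sc.
have cM := sc.2.
exists t; rewrite /tangent_map /= p1 /= phiK//.
have E : derive1 c t = dmap M psi (phi (c t)) (derive1 (phi \o c) t).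
  rewrite -[phi (c t)]/((phi \o c) t) -(derive1_comp_dmap t spsi spc).
  by have -> : psi \o (phi \o c) = c by apply/funext => s /=; rewrite phiK.
have tc : tangent M ((phi \o c) t) (derive1 (phi \o c) t).
  have [sc1 cM1] := spc; rewrite derive1E.
  exact: (tangent_derive coords_R (1 : R) openT sc1 (fun y _ => cM1 y) I).
have iso u v : tangent M (phi (c t)) u -> tangent M (phi (c t)) v ->
    bilin (g (c t)) (dmap M psi (phi (c t)) u) (dmap M psi (phi (c t)) v) =
    bilin (g (phi (c t))) u v.
  by move=> tu tw; rewrite -(isometry_dmap ipsi tu tw) phiK.
split=> //; [|by rewrite E iso|by rewrite iso].
have psiM' y : M y -> M (psi y).
  by move=> My; rewrite -psiM; exists y.
by have := tangent_dmap spsi psiM' tv; rewrite /= phiK.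
Qed.

(* The normal exponential map of phi o c is phi o E o d(psi), for E that of c. *)
Lemma thickness_radius_comp r :
  (exists E : 'rV[R]_n * 'rV[R]_n -> 'rV[R]_n,
    (forall p, normal_disc_bundle M g c r p -> is_exp M g p.1 p.2 (E p)) /\
    smooth_embedding (normal_disc_bundle M g c r) E) ->
  exists E : 'rV[R]_n * 'rV[R]_n -> 'rV[R]_n,
    (forall p, normal_disc_bundle M g (phi \o c) r p -> is_exp M g p.1 p.2 (E p)) /\
    smooth_embedding (normal_disc_bundle M g (phi \o c) r) E.
Proof.
move=> [E [expE [sE [E' [sE' E'K]]]]].
have [[sphi _] phiM _] := iphi; have [[spsi _] psiM _] := ipsi.
have phiM' x : M x -> M (phi x) by move=> Mx; rewrite -phiM; exists x.
have psiM' x : M x -> M (psi x) by move=> Mx; rewrite -psiM; exists x.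
have toB p : normal_disc_bundle M g (phi \o c) r p ->
    normal_disc_bundle M g c r (tangent_map M psi p).
  exact: tangent_map_normal_disc_bundle.
have TK p : tangent_bundle M p -> tangent_map M phi (tangent_map M psi p) = p.
  case: p => x v [/= Mx tv]; rewrite /tangent_map /= psiK//; congr pair.
  exact: (dmapK spsi psiM' sphi psiK tv).
have EM p : normal_disc_bundle M g c r p -> M (E p).
  by move=> Bp; exact: is_exp_in (expE _ Bp).
exists (phi \o E \o tangent_map M psi); split.
  move=> p Bp; have Tp := normal_disc_bundle_tangent Bp.
  have [_ tv] := normal_disc_bundle_tangent (toB _ Bp).
  (* This is the exponential at the image of [p] under both differentials, first that of [psi], then
     that of [phi]; [TK] brings it back to [p]. *)
  have := is_exp_comp iphi ipsi phiK psiK tv (expE _ (toB _ Bp)).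
  have e1 : phi (tangent_map M psi p).1 = p.1 := congr1 fst (TK _ Tp).
  have e2 : dmap M phi (tangent_map M psi p).1 (tangent_map M psi p).2 = p.2 :=
    congr1 snd (TK _ Tp).
  by rewrite e1 e2.
have cp := coords_prod (@coords_rV R n) (@coords_rV R n).
have cr := @coords_rV R n.
split.
  apply: (smooth_on_comp cp cr toB); last exact: (smooth_on_comp cr cr EM sE sphi).
  apply: smooth_onS (smooth_tangent_map spsi); exact: normal_disc_bundle_tangent.
(* The inverse reverses the three factors: [psi] undoes [phi], [E'] undoes [E], and the differential
   of [phi] undoes that of [psi]. *)
exists (tangent_map M phi \o E' \o psi); split.
  apply: (smooth_on_comp cr cp (A' := E @` normal_disc_bundle M g c r)).
  - move=> _ [p Bp <-] /=; exists (tangent_map M psi p); first exact: toB.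
    by rewrite phiK//; apply/EM/toB.
  - by apply: smooth_onS spsi => _ [p Bp <-] /=; apply/phiM'/EM/toB.
  - apply: (smooth_on_comp cp cp (A' := tangent_bundle M)) => //; last exact: smooth_tangent_map.
    by move=> _ [p Bp <-]; rewrite E'K//; exact: normal_disc_bundle_tangent Bp.
move=> p Bp /=; rewrite phiK ?E'K ?TK//; first exact: normal_disc_bundle_tangent Bp.
- exact: toB.
- exact/EM/toB.
Qed.

End Thickness.

Lemma Rop_comp phi psi c : is_isometry M g phi -> is_isometry M g psi ->
  (forall x, M x -> psi (phi x) = x) -> (forall x, M x -> phi (psi x) = x) ->
  smooth_curve_in M c -> Rop M g (phi \o c) = Rop M g c.
Proof.
move=> iphi ipsi phiK psiK sc; rewrite /Rop (Len_comp iphi sc); congr (_ / _).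
rewrite /Thi; congr sup; apply/seteqP; split=> r [r0 Er]; split=> //; last first.
  exact: (thickness_radius_comp iphi ipsi phiK psiK sc Er).
(* The other inclusion of radii is the same result for [psi] and the curve [phi \o c], since
   [psi \o (phi \o c)] is [c]. *)
have := thickness_radius_comp ipsi iphi psiK phiK (smooth_curve_in_comp iphi sc) Er.
by have -> : psi \o (phi \o c) = c by apply/funext => t /=; rewrite phiK//; exact: sc.2.
Qed.

End Ropelength.

(** * Widths of homotopy classes *)

Section BasedHomotopy.
Context {R : realType} (T : topologicalType) (A : set T) (a : T) (i : nat).
Implicit Types F : 'rV[R]_i.+1 -> T.

Lemma sphere_baseP : sphere (@sphere_base R i).
Proof.
rewrite /sphere /sphere_base /= (bigD1 ord0)//= big1 => [|j j0].
  by rewrite mxE eqxx expr1n addr0.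
by rewrite mxE (negPf j0) andbF expr0n.
Qed.

Lemma based_homotopic_refl F : based_map A a F -> based_homotopic A a F F.
Proof.
move=> bF; have [cF FA Fa] := bF; split=> //; exists (F \o snd); split=> //=.
(* The homotopy is constant in time. [F] is continuous only relative to the sphere, so
   neighbourhoods within the sphere are pulled back along the second projection. *)
- apply/subspace_continuousP => -[t z] [/= t01 Sz].
  have /subspace_continuousP/(_ z Sz) := cF; apply: cvg_trans => P /= nP.
  have : \forall p \near (t, z), sphere p.2 -> P (F p.2).
    exact: (@cvg_snd _ _ (nbhs t) (nbhs z) _ _ nP).
  by rewrite /nbhs /= /within /=; apply: filterS => -[s w] /= Q [_ Sw]; exact: Q.
- by move=> t z _; exact: FA.
Qed.

Lemma homotopy_group_self (alpha : set ('rV[R]_i.+1 -> T)) F :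
  homotopy_group R A a i alpha -> alpha F -> based_map A a F.
Proof. by move=> [F0 _ ->] []. Qed.

Lemma homotopy_group_nonempty (alpha : set ('rV[R]_i.+1 -> T)) :
  homotopy_group R A a i alpha -> alpha !=set0.
Proof. by move=> [F0 bF0 ->]; exists F0; exact: based_homotopic_refl. Qed.

Lemma homotopy_group_cst : A a -> homotopy_group R A a i (based_homotopic A a (cst a)).
Proof. by move=> Aa; exists (cst a) => //; split=> // x; exact: cst_continuous. Qed.

(* alpha is not empty, and a based homotopy starting at h o F carries with it the
   continuity of h o F, so that of h need not be known. *)
Lemma induced_map_comp (S : topologicalType) (h : S -> T) (alpha : set ('rV[R]_i.+1 -> T))
    (beta : set ('rV[R]_i.+1 -> S)) :
  homotopy_group R A a i alpha -> alpha = induced_map A a h beta ->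
  exists2 F, beta F & alpha (h \o F).
Proof.
move=> /homotopy_group_nonempty[F' +] alphaE; rewrite alphaE => -[F bF [bhF _ _]].
by exists F => //; exists F => //; exact: based_homotopic_refl.
Qed.

End BasedHomotopy.

Lemma width_constant (R : realType) (n : nat) (M : set 'rV[R]_n)
    (g : 'rV[R]_n -> 'M[R]_n) (A : set (@curve R n)) (c : @curve R n) (i : nat)
    (alpha : set ('rV[R]_i.+1 -> @curve R n)) F :
  homotopy_group R A c i alpha -> alpha F ->
  (forall z, sphere z -> Rop M g (F z) = Rop M g c) ->
  width M g alpha = (Rop M g c)%:E.
Proof.
move=> halpha aF FE; apply/eqP; rewrite eq_le; apply/andP; split.
  apply: (le_trans (ereal_inf_lbound (ex_intro2 _ _ F aF erefl))).
  by apply/ereal_supP => _ [z Sz <-]; rewrite FE.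
(* Lower bound: the supremum for any representative includes its value at the base point of the
   sphere. *)
apply/ereal_infP => _ [F' aF' <-]; apply: ereal_sup_ubound.
exists (sphere_base i); first exact: sphere_baseP.
by have [_ _ ->] := homotopy_group_self halpha aF'.
Qed.

(** The action of the inverse element is an isometry too, and inverts that of [a] on [M] by the
    action laws. *)
Lemma isometric_action_Rop (R : realType) (n : nat) (M : set 'rV[R]_n)
    (g : 'rV[R]_n -> 'M[R]_n) (G : topologicalGroupType) (act : G -> 'rV[R]_n -> 'rV[R]_n)
    (a : G) (c : R -> 'rV[R]_n) :
  isometric_action M g act -> smooth_curve_in M c -> Rop M g (act a \o c) = Rop M g c.
Proof.
move=> [_ act1 actM iact]; apply: (Rop_comp (psi := act (a^-1)%g)) => // x Mx.
  by rewrite -actM// mulVg act1.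
by rewrite -actM// mulgV act1.
Qed.

Theorem theorem5p4 (R : realType) (X : ambient_space)
    (g : 'rV[R]_(ambient_dim X) -> 'M[R]_(ambient_dim X))
    (EK : set (@curve R (ambient_dim X)))
    (G : topologicalGroupType)
    (act : G -> 'rV[R]_(ambient_dim X) -> 'rV[R]_(ambient_dim X))
    (gamma : @curve R (ambient_dim X)) :
  let M := points R X in
  let orbit_map : G -> @curve R (ambient_dim X) := fun a => act a \o gamma in
  let O := range orbit_map in
  let Lambda := Rop M g gamma in
  riemannian_metric M g ->
  knot_component M EK ->
  isometric_action M g act ->
  (forall (a : G) (c : @curve R (ambient_dim X)), EK c -> EK (act a \o c)) ->
  EK gamma ->
  [/\ forall c, O c -> Rop M g c = Lambda,
      forall (i : nat) alpha beta, (1 <= i)%N ->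
        homotopy_group R EK gamma i alpha ->
        homotopy_group R [set: G] 1%g i beta ->
        alpha = induced_map EK gamma orbit_map beta ->
        excess_width M g gamma alpha = 0%E
    & forall i : nat, (1 <= i)%N ->
        (forall alpha, homotopy_group R EK gamma i alpha ->
           exists2 beta, homotopy_group R O gamma i beta
                       & alpha = induced_map EK gamma id beta) ->
        [/\ forall alpha, homotopy_group R EK gamma i alpha ->
              width M g alpha = Lambda%:E,
            forall alpha, homotopy_group R EK gamma i alpha ->
              excess_width M g gamma alpha = 0%E
          & stabilisation_level M g i EK gamma = Lambda%:E]].
Proof.
move=> M orbit_map O Lambda _ [c0 _ EKE] iact _ EKgamma.
(* [gamma] is the endpoint of a path inside [Emb M], hence a smooth curve in [M]. *)
have sgamma : smooth_curve_in M gamma.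
  have := EKgamma; rewrite EKE => -[p [_ pE _ <-]].
  by have [] : Emb M (p 1) by apply: pE; rewrite /= in_itv /= ler01 lexx.
have RopO c : O c -> Rop M g c = Lambda.
  by move=> [a _ <-]; exact: isometric_action_Rop iact sgamma.
split=> // [i alpha beta _ halpha _ alphaE|i _ surj].
  (* The class contains [orbit_map \o F] for some [F] into the group, so this representative stays
     in the orbit. *)
  have [F _ aF] := induced_map_comp halpha alphaE.
  rewrite /excess_width (width_constant halpha aF) ?subee// => z _.
  by apply: RopO; exists (F z).
have widthE alpha : homotopy_group R EK gamma i alpha -> width M g alpha = Lambda%:E.
  move=> halpha; have [beta hbeta alphaE] := surj _ halpha.
  have [F bF aF] := induced_map_comp halpha alphaE.
  (* Here the representative comes from a class of based maps into [O], so its values on the sphere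
     lie in the orbit. *)
  apply: (width_constant halpha aF) => z Sz; apply: RopO.
  by have [_ FO _] := homotopy_group_self hbeta bF; exact: FO.
split=> // [alpha halpha|]; first by rewrite /excess_width widthE// subee.
(* The class of the constant map makes the set of widths nonempty; otherwise its supremum would be
   minus infinity. *)
have hc := @homotopy_group_cst R _ _ _ i EKgamma.
rewrite /stabilisation_level (_ : [set _ | _ in _] = [set Lambda%:E]) ?ereal_sup1//.
apply/seteqP; split=> [_ [alpha halpha <-]|_ ->] /=; first exact: widthE.
by exists (based_homotopic EK gamma (cst gamma)); rewrite // widthE.
Qed.
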